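(* Let $f:\mathbb{R}^n\to\mathbb{R}$ be $L_f$-Lipschitz continuous, let $\sigma>0$, and let $\phi(x)=\mathbb{E}_{u\sim\mathcal{N}(0,I)}[f(x+\sigma u)]$ be its Gaussian smoothing. Let $x\in\mathbb{R}^n$, $r>0$, $0<\delta<1$, and let $$g(x)=\frac1N\sum_{i=1}^N\frac{f(x+\sigma u_i)-f(x)}{\sigma}u_i,$$ where $u_1,\dots,u_N$ are independent random vectors with distribution $\mathcal{N}(0,I)$ on $\mathbb{R}^n$. If the sample size $N$ satisfies $$N\ge\frac{2n\|\nabla\phi(x)\|^2}{\delta r^2}+\frac{L_f^2n(n+2)(n+4)+8n(n+2)L_f^2+16nL_f^2}{4\delta r^2},$$ then $\|g(x)-\nabla\phi(x)\|\le r$ holds with probability at least $1-\delta$.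
   Context: $\|\cdot\|$ is the Euclidean norm; $\mathcal{N}(0,I)$ is the standard multivariate normal distribution on $\mathbb{R}^n$; $N$ is a positive integer. *)

(* Defs.v *)
From HB Require Import structures.
From mathcomp Require Import all_boot all_order all_algebra.
From mathcomp Require Import all_classical all_reals all_analysis.

Set Implicit Arguments.
Unset Strict Implicit.
Unset Printing Implicit Defensive.

Import Order.TTheory GRing.Theory Num.Theory.
Import numFieldNormedType.Exports.

Local Open Scope classical_set_scope.
Local Open Scope ring_scope.

(* Row vectors carry the sigma-algebra generated by the coordinate maps, like
   the library's [n.-tuple T]; on ['rV[R]_n] it is the Borel sigma-algebra. *)
Definition measure_rV_display : measure_display -> measure_display.
Proof. exact. Qed.

Section measurable_rV.
Context {d} {T : measurableType d} (n : nat).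

Definition rV_coord (i : 'I_n) (v : 'rV[T]_n) : T := v ord0 i.

Let rV_set0 : g_sigma_preimage rV_coord set0.
Proof. exact: sigma_algebra0. Qed.

Let rV_setC A : g_sigma_preimage rV_coord A -> g_sigma_preimage rV_coord (~` A).
Proof. exact: sigma_algebraC. Qed.

Let rV_bigcup (F : (set 'rV[T]_n)^nat) :
  (forall i, g_sigma_preimage rV_coord (F i)) ->
  g_sigma_preimage rV_coord (\bigcup_i (F i)).
Proof. exact: sigma_algebra_bigcup. Qed.

HB.instance Definition _ := @isMeasurable.Build (measure_rV_display d)
  'rV[T]_n (g_sigma_preimage rV_coord) rV_set0 rV_setC rV_bigcup.

End measurable_rV.

Lemma measurable_rV_coord d (T : measurableType d) n (i : 'I_n) :
  measurable_fun [set: 'rV[T]_n] (@rV_coord d T n i).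
Proof.
move=> _ Y mY; rewrite setTI; apply: sub_sigma_algebra => /=.
rewrite -bigcup_seq/=; exists i => /=; first by rewrite mem_index_enum.
by exists Y => //; rewrite setTI.
Qed.

Lemma measurable_fun_rVP d1 d2 (T1 : measurableType d1)
    (T2 : measurableType d2) n (f : T1 -> 'rV[T2]_n) :
  measurable_fun [set: T1] f <->
  forall i, measurable_fun [set: T1] (rV_coord i \o f).
Proof.
split=> [mf i|mf]; first by apply: measurableT_comp => //; exact: measurable_rV_coord.
have sub : g_sigma_preimage (fun i => @rV_coord d2 T2 n i \o f) `<=` measurable.
  apply: smallest_sub; first exact: sigma_algebra_measurable.
  case: n => [|n] in f mf *; first by rewrite big_ord0.
  rewrite -bigcup_mkord_ord; apply: bigcup_sub => i Ii.
  by move=> A [B mB <-]; exact: mf.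
rewrite g_sigma_preimage_comp in sub.
by move=> _ A mA; apply: sub; exists A.
Qed.

Section std_normal.
Context (R : realType).

(* [normal_prob] lives on [measurableTypeR R], which has the same measurable
   sets as [R] but a different display. *)
Definition rV_cons n (p : measurableTypeR R * 'rV[R]_n) : 'rV[R]_n.+1 :=
  row_mx p.1%:M p.2.

Lemma rV_cons_ord0 n (p : measurableTypeR R * 'rV[R]_n) :
  rV_cons p ord0 ord0 = p.1.
Proof.
have -> : ord0 = lshift n (ord0 : 'I_1) :> 'I_n.+1 by exact/val_inj.
by apply: etrans (row_mxEl p.1%:M p.2 ord0 ord0) _; rewrite mxE eqxx mulr1n.
Qed.

Lemma rV_cons_lift n (p : measurableTypeR R * 'rV[R]_n) i :
  rV_cons p ord0 (lift ord0 i) = p.2 ord0 i.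
Proof.
have -> : lift ord0 i = rshift 1 i :> 'I_n.+1 by exact/val_inj.
exact: (row_mxEr p.1%:M p.2 ord0 i).
Qed.

Let measurable_rV_cons n :
  measurable_fun [set: measurableTypeR R * 'rV[R]_n] (@rV_cons n).
Proof.
apply/measurable_fun_rVP => i; case: (unliftP ord0 i) => [j|] ->.
  rewrite (_ : _ \o _ = rV_coord j \o snd); last first.
    by apply/funext => p; exact: rV_cons_lift.
  by apply: measurableT_comp => //; exact: measurable_rV_coord.
rewrite (_ : _ \o _ = fst)//.
by apply/funext => p; exact: rV_cons_ord0.
Qed.

HB.instance Definition _ n :=
  @isMeasurableFun.Build _ _ _ _ (@rV_cons n) (@measurable_rV_cons n).

(* N(0, I) on R^n, as the law of a vector of n independent N(0, 1) coordinates. *)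
Fixpoint std_normal n : probability 'rV[R]_n R :=
  match n with
  | 0 => \d_(0 : 'rV[R]_0)
  | m.+1 => distribution (normal_prob 0 1 \x std_normal m)%E (@rV_cons m)
  end.

Lemma std_normal_box n (A : 'I_n -> set R) : (forall i, measurable (A i)) ->
  std_normal n [set v : 'rV[R]_n | forall i, A i (v ord0 i)] =
  (\prod_(i < n) normal_prob 0 1 (A i))%E.
Proof.
elim: n A => [|n IH] A mA /=.
  by rewrite big_ord0 diracE mem_set// => -[].
have -> : @rV_cons n @^-1` [set v : 'rV[R]_n.+1 | forall i, A i (v ord0 i)] =
    A ord0 `*` [set v : 'rV[R]_n | forall i, A (lift ord0 i) (v ord0 i)].
  apply/seteqP; split=> [p /= Ap|p /= [A0 Ap] i].
    split; first by have := Ap ord0; rewrite rV_cons_ord0.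
    by move=> i; have := Ap (lift ord0 i); rewrite rV_cons_lift.
  by case: (unliftP ord0 i) => [j|] ->; rewrite ?rV_cons_lift ?rV_cons_ord0.
have mB : measurable [set v : 'rV[R]_n | forall i, A (lift ord0 i) (v ord0 i)].
  rewrite (_ : mkset _ =
      \bigcap_(i in [set: 'I_n]) (rV_coord i @^-1` A (lift ord0 i))).
    apply: fin_bigcap_measurable => // i _.
    by rewrite -[X in measurable X]setTI; exact: measurable_rV_coord.
  by apply/seteqP; split=> v /= Av i; [move=> _; exact: Av|exact: Av].
have mA0 : measurable (A ord0 : set (measurableTypeR R)) by exact: mA.
rewrite product_measure1E// big_ord_recl; congr (_ * _)%E.
exact: IH.
Qed.

End std_normal.

(* The norm of the normed module ['rV[R]_n] is the sup norm. *)
Definition enorm (R : realType) n (v : 'rV[R]_n) : R :=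
  Num.sqrt (\sum_(i < n) v ord0 i ^+ 2).

Definition elipschitz (R : realType) n (L : R) (f : 'rV[R]_n -> R) : Prop :=
  forall x y, `|f x - f y| <= L * enorm (x - y).

(* The vector of partial derivatives; as ['D_v f x] is total, this is only
   meaningful where they exist, which is everywhere for the Gaussian smoothing
   of a Lipschitz function. *)
Definition gradient (R : realType) n (f : 'rV[R]_n -> R) (x : 'rV[R]_n) :
    'rV[R]_n :=
  \row_(i < n) 'D_(delta_mx ord0 i) f x.

Definition gauss_smoothing (R : realType) n (sigma : R) (f : 'rV[R]_n -> R)
    (x : 'rV[R]_n) : R :=
  fine 'E_(std_normal R n)[fun u => f (x + sigma *: u)].

Definition grad_estimate (R : realType) n N (sigma : R) (f : 'rV[R]_n -> R)
    (u : 'I_N -> 'rV[R]_n) (x : 'rV[R]_n) : 'rV[R]_n :=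
  N%:R^-1 *: \sum_(i < N) ((f (x + sigma *: u i) - f x) / sigma) *: u i.

Definition mutually_independent d d' (T : measurableType d)
    (T' : measurableType d') (R : realType) (P : probability T R)
    (I : finType) (X : I -> {RV P >-> T'}) : Prop :=
  forall (J : {set I}) (A : I -> set T'), (forall i, measurable (A i)) ->
  P (\bigcap_(i in [set` J]) X i @^-1` A i) =
  (\prod_(i in J) P (X i @^-1` A i))%E.

(* Laws are compared on measurable sets only, as a measure is a total function
   whose values elsewhere carry no meaning. *)
Definition has_law d d' (T : measurableType d) (T' : measurableType d')
    (R : realType) (P : probability T R) (X : {RV P >-> T'})
    (Q : probability T' R) : Prop :=
  forall A, measurable A -> distribution P X A = Q A.

(* Main.v *)
Require Import Defs.
From HB Require Import structures.
From mathcomp Require Import all_boot all_order all_algebra.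
From mathcomp Require Import all_classical all_reals all_analysis.
From mathcomp Require Import measurable_realfun.
From mathcomp Require Import ring lra.

Set Implicit Arguments.
Unset Strict Implicit.
Unset Printing Implicit Defensive.

Import Order.TTheory GRing.Theory Num.Theory.
Import numFieldNormedType.Exports.

Local Open Scope classical_set_scope.
Local Open Scope ring_scope.

(** Write [gamma] for the standard normal law on R^n and let [G_j v] be the
    [j]-th coordinate [(f (x + sigma v) - f x) / sigma * v_j] of one sample of
    the estimator.

    Unbiasedness: the gradient of the smoothing is the mean of a sample.  Moving
    [x] by [t e_j] amounts to moving the Gaussian vector by [(t / sigma) e_j],
    and a shifted Gaussian has density [exp (s v_j - s^2 / 2)] with respect to
    the original one ([cameron_martin]).  So [f], which is only Lipschitz, never
    gets differentiated: the parameter sits in a smooth weight, and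
    differentiation under the integral sign gives
    [d/dt E F(v + t e_j) = E (F(v) v_j)] at [t = 0] for every square integrable
    [F] ([is_derive_gauss_shift]).  The case of [f] is
    [gradient_gauss_smoothing]; the term [f x] in [G_j] is harmless because
    [E v_j = 0].

    Second moment: [F v = v_j] and [F v = v_j^3] in the same formula give
    [E v_j^2 = 1] and then [E v_j^4 = 3 E v_j^2 = 3].  As
    [G_j^2 <= L^2 |v|^2 v_j^2 <= (L^2 / 2) sum_k (v_k^4 + v_j^4)], this yields
    [E G_j^2 <= 3 n L^2] ([Rintegral_grad_sample_sqr]).

    Averaging: the centred samples [G_j - E G_j] are pairwise orthogonal in L^2
    ([Rintegral_indep_mul_eq0]), so the mean square error of the estimator is at
    most [3 n^2 L^2 / N], and Markov's inequality bounds the probability of an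
    error above [r] by [3 n^2 L^2 / (N r^2)].  The sample size makes this at most
    [delta], since
    [n (n+2) (n+4) + 8 n (n+2) + 16 n = 12 n^2 + n (n^2 + 2 n + 40)]. *)

(** * Translating a one-dimensional Gaussian *)

Section density.
Local Open Scope ereal_scope.
Import HBNNSimple.

(** The defining property of a density extends from sets to nonnegative
    functions by simple approximation from below. *)
Lemma ge0_integral_density d (T : measurableType d) (R : realType)
    (mu nu : {measure set T -> \bar R}) (p : T -> R) (f : T -> \bar R) :
  measurable_fun [set: T] p -> (forall x, 0 <= p x)%R ->
  (forall A, measurable A -> nu A = \int[mu]_(x in A) (p x)%:E) ->
  measurable_fun [set: T] f -> (forall x, 0 <= f x) ->
  \int[nu]_x f x = \int[mu]_x (f x * (p x)%:E).
Proof.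
move=> mp p0 nuE mf f0.
have mpE : measurable_fun [set: T] (EFin \o p) by exact/measurable_EFinP.
pose h := nnsfun_approx measurableT mf.
have hf x : (EFin \o h n) x @[n --> \oo] --> f x by exact: cvg_nnsfun_approx.
have hnd x a b : (a <= b)%N -> ((h a x)%:E <= (h b x)%:E).
  by move=> ab; rewrite lee_fin; exact/lefP/nd_nnsfun_approx.
have -> : \int[nu]_x f x = limn (fun n => \int[nu]_x (h n x)%:E).
  rewrite -monotone_convergence//; last 3 first.
  - by move=> n; exact/measurable_EFinP.
  - by move=> n x _; rewrite lee_fin.
  - by move=> x _ a b; exact: hnd.
  by apply: eq_integral => x _; apply/esym/cvg_lim => //; exact: hf.
have -> : \int[mu]_x (f x * (p x)%:E) =
    limn (fun n => \int[mu]_x ((h n x)%:E * (p x)%:E)).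
  rewrite -monotone_convergence//; last 3 first.
  - by move=> n; apply: emeasurable_funM => //; exact/measurable_EFinP.
  - by move=> n x _; rewrite mule_ge0 ?lee_fin.
  - by move=> x _ a b ab; rewrite lee_wpmul2r ?lee_fin//; exact: hnd.
  by apply: eq_integral => x _; apply/esym/cvg_lim => //; apply: cvgeZr => //; exact: hf.
congr (limn _); apply/funext => n.
under eq_integral do rewrite fimfunE -fsumEFin//.
rewrite ge0_integral_fsum//; last 2 first.
- by move=> y; apply/measurable_EFinP; exact: measurable_funM.
- by move=> y x _; rewrite nnfun_muleindic_ge0.
under [RHS]eq_integral => x _.
  rewrite fimfunE -fsumEFin// ge0_mule_fsuml => [|y]; last first.
    exact: nnfun_muleindic_ge0.
  over.
rewrite ge0_integral_fsum//; last 2 first.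
- move=> y; apply: emeasurable_funM => //.
  by apply/measurable_EFinP; exact: measurable_funM.
- move=> y x _; apply: mule_ge0; last by rewrite lee_fin.
  exact: nnfun_muleindic_ge0.
apply: eq_fsbigr => r /[1!inE] -[t _ rE].
have r0 : (0 <= r)%R by rewrite -rE.
have mA : measurable (h n @^-1` [set r]) by [].
under eq_integral do rewrite EFinM.
rewrite ge0_integralZl//; last exact/measurable_EFinP.
rewrite integral_indic// setIT nuE//.
under [RHS]eq_integral do rewrite EFinM -muleA.
rewrite ge0_integralZl//; last 2 first.
- by apply: emeasurable_funM => //; exact/measurable_EFinP.
- by move=> *; rewrite mule_ge0 ?lee_fin.
congr (_ * _); rewrite [LHS]integral_mkcond; apply: eq_integral => x _.
by rewrite epatch_indic /= muleC.
Qed.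

End density.

Section one_dim.
Context {R : realType}.
Local Notation mu := (@lebesgue_measure R).
Local Open Scope ereal_scope.

(** The image of Lebesgue measure under a translation gives each half-open
    interval its length, and this determines Lebesgue measure. *)
Lemma ge0_integral_lebesgue_shift (f : measurableTypeR R -> \bar R) (t : R) :
  measurable_fun [set: measurableTypeR R] f -> (forall x, 0 <= f x) ->
  \int[mu]_x f (x + t)%R = \int[mu]_x f x.
Proof.
move=> mf f0.
pose shift (x : measurableTypeR R) : measurableTypeR R := (x + t)%R.
have mshift : measurable_fun [set: measurableTypeR R] shift.
  exact: measurable_funD.
pose mshift_mixin := isMeasurableFun.Build _ _ _ _ shift mshift.
pose mfshift : {mfun measurableTypeR R >-> measurableTypeR R} :=
  HB.pack shift mshift_mixin.
rewrite -[LHS](@ge0_integral_pushforward _ _ _ _ _ _ mshift mu setT f)//.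
apply: eq_measure_integral => A mA _; apply/esym.
apply: (@lebesgue_measure_unique _ (pushforward mu mfshift)) => // _ [[a b] _ <-].
rewrite [RHS]/= /pushforward (_ : _ @^-1` _ = [set` `](a - t)%R, (b - t)%R]]); last first.
  by apply/seteqP; split=> x /=; rewrite !in_itv/= ltrBlDr lerBrDr.
by rewrite !lebesgue_measure_itv/= !lte_fin ltrD2r -!EFinB opprB addrA subrK.
Qed.

Lemma normal_pdf_shift (s t : R) :
  normal_pdf 0 1 (s - t) = (expR (t * s - t ^+ 2 / 2) * normal_pdf 0 1 s)%R.
Proof.
rewrite !normal_pdfE ?oner_neq0//= mulrCA /normal_fun; congr *%R.
by rewrite -expRD; congr expR; rewrite expr1n; field.
Qed.

Lemma ge0_integral_normal_prob (f : measurableTypeR R -> \bar R) (m s : R) :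
  measurable_fun [set: measurableTypeR R] f -> (forall x, 0 <= f x) ->
  \int[normal_prob m s]_x f x = \int[mu]_x (f x * (normal_pdf m s x)%:E).
Proof.
move=> mf f0; apply: ge0_integral_density => //; last exact: normal_pdf_ge0.
exact: measurable_normal_pdf.
Qed.

(** Translation invariance moves the shift from the integrand to the density,
    where completing the square turns it into an exponential factor. *)
Lemma ge0_cameron_martin1 (f : measurableTypeR R -> \bar R) (t : R) :
  measurable_fun [set: measurableTypeR R] f -> (forall x, 0 <= f x) ->
  \int[normal_prob 0 1]_s f (s + t)%R =
  \int[normal_prob 0 1]_s (f s * (expR (t * s - t ^+ 2 / 2))%:E).
Proof.
move=> mf f0.
have mpdf : measurable_fun [set: measurableTypeR R]
    (fun s : measurableTypeR R => (normal_pdf 0 1 s)%:E).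
  by apply/measurable_EFinP; exact: measurable_normal_pdf.
have mt : measurable_fun [set: measurableTypeR R]
    (fun x : measurableTypeR R => f (x + t)%R).
  by apply: measurableT_comp mf _; exact: measurable_funD.
have me : measurable_fun [set: measurableTypeR R]
    (fun s : measurableTypeR R => (expR (t * s - t ^+ 2 / 2))%:E).
  apply/measurable_EFinP; apply: measurableT_comp => //.
  by apply: measurable_funB => //; exact: measurable_funM.
rewrite !ge0_integral_normal_prob//; last 2 first.
- exact: emeasurable_funM.
- by move=> x; rewrite mule_ge0// lee_fin expR_ge0.
rewrite -[RHS](@ge0_integral_lebesgue_shift _ t); last 2 first.
- by do 2 apply: emeasurable_funM => //.
- by move=> x; rewrite !mule_ge0// lee_fin ?expR_ge0 ?normal_pdf_ge0.
apply: eq_integral => s _; rewrite -muleA -EFinM.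
by rewrite -normal_pdf_shift addrK.
Qed.

End one_dim.

(** * Translating a Gaussian vector along a coordinate *)

Section cameron_martin.
Context {R : realType}.

Lemma measurable_rV_shift n (a : 'rV[R]_n) :
  measurable_fun [set: 'rV[R]_n] (fun v => v + a).
Proof.
apply/measurable_fun_rVP => i.
rewrite (_ : _ \o _ = fun v : 'rV[R]_n => v ord0 i + a ord0 i); last first.
  by apply/funext => v /=; rewrite /rV_coord mxE.
by apply: measurable_funD => //; exact: measurable_rV_coord.
Qed.

Lemma rV_shiftE n (v : 'rV[R]_n) (t : R) (j i : 'I_n) :
  (v + t *: delta_mx ord0 j) ord0 i = v ord0 i + t * (i == j)%:R.
Proof. by rewrite !mxE. Qed.

Lemma rV_cons_shift0 n (p : measurableTypeR R * 'rV[R]_n) (t : R) :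
  rV_cons p + t *: delta_mx ord0 ord0 =
  rV_cons ((p.1 + t : measurableTypeR R), p.2).
Proof.
apply/rowP => i; rewrite rV_shiftE; case: (unliftP ord0 i) => [k|] ->.
  by rewrite !rV_cons_lift eq_sym eq_liftF mulr0 addr0.
by rewrite !rV_cons_ord0 eqxx mulr1.
Qed.

Lemma rV_cons_shift_lift n (p : measurableTypeR R * 'rV[R]_n) (t : R) j :
  rV_cons p + t *: delta_mx ord0 (lift ord0 j) =
  rV_cons (p.1, p.2 + t *: delta_mx ord0 j).
Proof.
apply/rowP => i; rewrite rV_shiftE; case: (unliftP ord0 i) => [k|] ->.
  by rewrite !rV_cons_lift rV_shiftE (inj_eq lift_inj).
by rewrite !rV_cons_ord0 eq_liftF mulr0 addr0.
Qed.

Lemma measurable_cons n :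
  measurable_fun [set: measurableTypeR R * 'rV[R]_n] (@rV_cons R n).
Proof. exact: measurable_funPT. Qed.

Local Open Scope ereal_scope.

Lemma ge0_integral_std_normalS n (f : 'rV[R]_n.+1 -> \bar R) :
  measurable_fun setT f -> (forall v, 0 <= f v) ->
  \int[std_normal R n.+1]_v f v =
  \int[(normal_prob 0 1 \x std_normal R n)%E]_p f (rV_cons p).
Proof. by move=> mf f0; rewrite [LHS]ge0_integral_distribution. Qed.

Lemma measurable_cm_weight n (j : 'I_n) (t : R) :
  measurable_fun [set: 'rV[R]_n]
    (fun v => expR (t * v ord0 j - t ^+ 2 / 2))%R.
Proof.
apply: measurableT_comp => //; apply: measurable_funB => //.
by apply: measurable_funM => //; exact: measurable_rV_coord.
Qed.

(** Integrate first over the one coordinate that is shifted: Tonelli's theorem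
    brings the formula down to dimension one, peeling off the first coordinate
    by induction when it is another one. *)
Lemma ge0_cameron_martin n (j : 'I_n) (t : R) (f : 'rV[R]_n -> \bar R) :
  measurable_fun setT f -> (forall v, 0 <= f v) ->
  \int[std_normal R n]_v f (v + t *: delta_mx ord0 j)%R =
  \int[std_normal R n]_v (f v * (expR (t * v ord0 j - t ^+ 2 / 2))%:E).
Proof.
elim: n j f => [[]//|n IH] j f mf f0.
have mw : measurable_fun [set: 'rV[R]_n.+1]
    (fun v => (expR (t * v ord0 j - t ^+ 2 / 2))%:E).
  by apply/measurable_EFinP; exact: measurable_cm_weight.
have mfs : measurable_fun [set: 'rV[R]_n.+1]
    (fun v => f (v + t *: delta_mx ord0 j)%R).
  exact: measurableT_comp mf (measurable_rV_shift _).
have mfw : measurable_fun [set: 'rV[R]_n.+1]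
    (fun v => f v * (expR (t * v ord0 j - t ^+ 2 / 2))%:E).
  exact: emeasurable_funM.
have fw0 (v : 'rV[R]_n.+1) : 0 <= f v * (expR (t * v ord0 j - t ^+ 2 / 2))%:E.
  by rewrite mule_ge0// lee_fin expR_ge0.
rewrite !ge0_integral_std_normalS//.
have mfc := measurableT_comp mf (@measurable_cons n).
have mfsc := measurableT_comp mfs (@measurable_cons n).
have mfwc := measurableT_comp mfw (@measurable_cons n).
case: (unliftP ord0 j) => [k|] jE.
- rewrite [LHS](fubini_tonelli1 _ mfsc) => [|p]; last exact: f0.
  rewrite [RHS](fubini_tonelli1 _ mfwc) => [|p]; last exact: fw0.
  apply: eq_integral => s _; rewrite /fubini_F /=.
  have mfcs : measurable_fun setT (fun v => f (rV_cons (s, v))).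
    exact: measurableT_comp mfc (pair1_measurable s).
  transitivity (\int[std_normal R n]_v
      f (rV_cons (s, v + t *: delta_mx ord0 k)%R)).
    by apply: eq_integral => v _; rewrite jE rV_cons_shift_lift.
  have f0s v : 0 <= f (rV_cons (s, v)) by exact: f0.
  apply: etrans (IH k (fun v => f (rV_cons (s, v))) mfcs f0s) _.
  by apply: eq_integral => v _; rewrite jE rV_cons_lift.
- rewrite [LHS](fubini_tonelli2 _ mfsc) => [|p]; last exact: f0.
  rewrite [RHS](fubini_tonelli2 _ mfwc) => [|p]; last exact: fw0.
  apply: eq_integral => v _; rewrite /fubini_G /=.
  have mfcv : measurable_fun setT (fun s => f (rV_cons (s, v))).
    exact: measurableT_comp mfc (pair2_measurable v).
  transitivity (\int[normal_prob 0 1]_s f (rV_cons (s + t, v)%R)).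
    by apply: eq_integral => s _; rewrite jE rV_cons_shift0.
  have f0v s : 0 <= f (rV_cons (s, v)) by exact: f0.
  apply: etrans (@ge0_cameron_martin1 _ (fun s => f (rV_cons (s, v))) t mfcv f0v) _.
  by apply: eq_integral => s _; rewrite jE rV_cons_ord0.
Qed.

(** Both integrals are differences of the integrals of a positive and a negative
    part, and multiplication by the nonnegative weight respects this
    splitting. *)
Lemma cameron_martin n (j : 'I_n) (t : R) (f : 'rV[R]_n -> R) :
  measurable_fun setT f ->
  \int[std_normal R n]_v (f (v + t *: delta_mx ord0 j)%R)%:E =
  \int[std_normal R n]_v (f v * expR (t * v ord0 j - t ^+ 2 / 2))%:E.
Proof.
move=> mf; rewrite integralE [RHS]integralE.
have mfE : measurable_fun setT (EFin \o f) by exact/measurable_EFinP.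
congr (_ - _).
- transitivity (\int[std_normal R n]_v
      ((EFin \o f)^\+ (v + t *: delta_mx ord0 j)%R)).
    by apply: eq_integral => v _; rewrite !funeposE.
  rewrite ge0_cameron_martin//; last exact: measurable_funepos.
  apply: eq_integral => v _; rewrite !funeposE /= EFinM.
  by rewrite maxeMl ?mul0e ?lee_fin ?expR_ge0.
- transitivity (\int[std_normal R n]_v
      ((EFin \o f)^\- (v + t *: delta_mx ord0 j)%R)).
    by apply: eq_integral => v _; rewrite !funenegE.
  rewrite ge0_cameron_martin//; last exact: measurable_funeneg.
  apply: eq_integral => v _; rewrite !funenegE /= -[in RHS](mulNr (f v)) EFinM. 
  by rewrite maxeMl ?mul0e ?lee_fin ?expR_ge0.
Qed.

End cameron_martin.

(** * Real integrable functions on a probability space *)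

Section integrable_real.
Context d (T : measurableType d) (R : realType) (P : probability T R).
Implicit Types f g : T -> R.

Lemma integrable_dominated f g : measurable_fun setT f ->
  (forall x, `|f x| <= g x) -> P.-integrable setT (EFin \o g) ->
  P.-integrable setT (EFin \o f).
Proof.
move=> mf fg; apply: le_integrable => //; first exact/measurable_EFinP.
by move=> x _; rewrite lee_fin (le_trans (fg x))// ler_norm.
Qed.

Lemma integrable_measurable f :
  P.-integrable setT (EFin \o f) -> measurable_fun setT f.
Proof. by move/measurable_int/measurable_EFinP. Qed.

Lemma integrable_addR f g : P.-integrable setT (EFin \o f) ->
  P.-integrable setT (EFin \o g) ->
  P.-integrable setT (EFin \o (fun x => f x + g x)).
Proof. by move=> fi gi; exact: (integrableD measurableT fi gi). Qed.

Lemma integrable_scaleR f (k : R) : P.-integrable setT (EFin \o f) ->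
  P.-integrable setT (EFin \o (fun x => k * f x)).
Proof. by move=> fi; exact: (integrableZl measurableT k fi). Qed.

Lemma integrable_cstR (k : R) : P.-integrable setT (EFin \o (fun=> k)).
Proof. exact: (finite_measure_integrable_cst P k). Qed.

Lemma Rintegral_cstT (k : R) : \int[P]_x k = k.
Proof. by rewrite Rintegral_cst// [X in _ * fine X]probability_setT mulr1. Qed.

Lemma integrable_mul_sqr f g : measurable_fun setT f -> measurable_fun setT g ->
  P.-integrable setT (EFin \o (fun x => f x ^+ 2)) ->
  P.-integrable setT (EFin \o (fun x => g x ^+ 2)) ->
  P.-integrable setT (EFin \o (fun x => f x * g x)).
Proof.
move=> mf mg if2 ig2.
apply: (@integrable_dominated _ (fun x => f x ^+ 2 + g x ^+ 2)).
- exact: measurable_funM.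
- move=> x; have h1 := sqr_ge0 (f x - g x); have h2 := sqr_ge0 (f x + g x).
  by rewrite ler_norml; apply/andP; split; nra.
- exact: integrable_addR.
Qed.

Lemma integrable_sqr_integrable f : measurable_fun setT f ->
  P.-integrable setT (EFin \o (fun x => f x ^+ 2)) ->
  P.-integrable setT (EFin \o f).
Proof.
move=> mf if2; apply: (@integrable_dominated _ (fun x => 1 + f x ^+ 2)) => //.
  move=> x; have := sqr_ge0 (f x - 1); have := sqr_ge0 (f x + 1).
  by move=> h1 h2; rewrite ler_norml; apply/andP; split; nra.
by apply: integrable_addR if2; exact: integrable_cstR.
Qed.

Lemma Rintegral_sum (I : Type) (r : seq I) (Q : pred I) (h : I -> T -> R) :
  (forall i, P.-integrable setT (EFin \o h i)) ->
  \int[P]_x (\sum_(i <- r | Q i) h i x) = \sum_(i <- r | Q i) \int[P]_x h i x.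
Proof.
move=> ih; rewrite /Rintegral.
under eq_integral do rewrite -sumEFin.
rewrite integral_sum// -[RHS]/(fine (_)%:E) -sumEFin.
congr fine; apply: eq_bigr => i _; rewrite fineK//.
exact: (integrable_fin_num measurableT (ih i)).
Qed.

Lemma integrable_sumR (I : Type) (r : seq I) (h : I -> T -> R) :
  (forall i, P.-integrable setT (EFin \o h i)) ->
  P.-integrable setT (EFin \o (fun x => \sum_(i <- r) h i x)).
Proof.
move=> ih; rewrite (_ : _ \o _ = fun x => \sum_(i <- r) (EFin \o h i) x)%E.
  exact: integrable_sum.
by apply/funext => x /=; rewrite sumEFin.
Qed.

End integrable_real.

(** * Integrability of exponentials and powers of Gaussian coordinates *)

Section gaussian.
Context {R : realType}.
Local Notation gauss n := (std_normal R n).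

Lemma measurable_coord n (j : 'I_n) :
  measurable_fun [set: 'rV[R]_n] (fun v => v ord0 j : R).
Proof. exact: measurable_rV_coord. Qed.

(** The shift formula for a constant integrand computes the exponential moments
    of a coordinate. *)
Lemma integrable_expR_coord n (j : 'I_n) (t : R) :
  (gauss n).-integrable setT (EFin \o (fun v => expR (t * v ord0 j))).
Proof.
have mt : measurable_fun [set: 'rV[R]_n] (fun v => expR (t * v ord0 j) : R).
  apply: measurableT_comp => //.
  by apply: measurable_funM => //; exact: measurable_coord.
apply/integrableP; split; first exact/measurable_EFinP.
have e0 : (0 <= (expR (t ^+ 2 / 2))%:E)%E by rewrite lee_fin expR_ge0.
have cm := @ge0_cameron_martin R n j t (cst (expR (t ^+ 2 / 2))%:E)
  (measurable_cst _) (fun=> e0).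
under eq_integral => v _.
  rewrite /= ger0_norm ?expR_ge0// -(subrK (t ^+ 2 / 2) (t * _)) expRD mulrC.
  over.
rewrite -cm integral_cst// [X in (_ * X)%E](@probability_setT _ _ R (gauss n)).
by rewrite mule1 ltry.
Qed.

Lemma expR_norm_le (s : R) : expR `|s| <= expR s + expR (- s).
Proof.
by have [_|_] := ger0P s; rewrite ?lerDl ?lerDr expR_ge0.
Qed.

(** A term of the exponential series is at most its sum, so exponential moments
    dominate all polynomial ones. *)
Lemma integrable_coordX n (j : 'I_n) k :
  (gauss n).-integrable setT (EFin \o (fun v => v ord0 j ^+ k)).
Proof.
apply: (@integrable_dominated _ _ _ (gauss n) _
    (fun v => k`!%:R * (expR (1 * v ord0 j) + expR (- 1 * v ord0 j)))).
- by apply: measurable_funX; exact: measurable_coord.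
- move=> v; rewrite mul1r mulN1r normrX.
  apply: (@le_trans _ _ (k`!%:R * expR `|v ord0 j|)); last first.
    by rewrite ler_pM2l ?expR_norm_le// ltr0n fact_gt0.
  rewrite mulrC -ler_pdivrMr ?ltr0n ?fact_gt0//.
  case: k => [|k]; first by rewrite expr0 fact0 divr1 -[leLHS]expR0 ler_expR.
  by apply: le_trans (expR_ge1Dxn k (normr_ge0 _)); rewrite lerDr.
- by apply/integrable_scaleR/integrable_addR; exact: integrable_expR_coord.
Qed.

End gaussian.

(** * Gaussian integration by parts and moments *)

Section gaussian_derivative.
Context {R : realType}.
Local Notation gauss n := (std_normal R n).

Lemma is_derive_cm_weight (c s t : R) :
  is_derive t 1 (fun x => c * expR (x * s - x ^+ 2 / 2))
    (c * ((s - t) * expR (t * s - t ^+ 2 / 2))).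
Proof.
pose g (x : R) := s * x - 2^-1 * x ^+ 2.
have dg : is_derive t 1 g (s * 1 - 2^-1 * (2 * t ^+ 1 * 1)).
  exact: (is_deriveB (is_deriveZ s (is_derive_id t 1))
    (is_deriveZ 2^-1 (is_deriveX 2 (is_derive_id t 1)))).
have d : is_derive t 1 (fun x => c * expR (g x))
    (c * (expR (g t) * (s * 1 - 2^-1 * (2 * t ^+ 1 * 1)))).
  exact: (is_deriveZ c (is_derive1_comp (is_derive_expR (g t)) dg)).
have gE x : g x = x * s - x ^+ 2 / 2 by rewrite /g; ring.
rewrite (_ : (fun x => _) = (fun x => c * expR (g x))); last first.
  by apply/funext => x; rewrite gE.
by apply: (is_derive_eq d); rewrite gE [X in c * X]mulrC; congr (c * (_ * _)); field.
Qed.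

(** Gaussian integration by parts without any smoothness of [F]: the shift
    formula transfers the parameter to the weight [exp (t v_j - t^2 / 2)], whose
    derivative at [0] is [v_j]. *)
Lemma is_derive_gauss_shift n (j : 'I_n) (F : 'rV[R]_n -> R) :
  measurable_fun setT F ->
  (gauss n).-integrable setT (EFin \o (fun v => F v ^+ 2)) ->
  is_derive (0 : R) 1
    (fun t => \int[gauss n]_v F (v + t *: delta_mx ord0 j))
    (\int[gauss n]_v (F v * v ord0 j)).
Proof.
move=> mF iF2.
pose w (t : R) (v : 'rV[R]_n) := F v * expR (t * v ord0 j - t ^+ 2 / 2).
rewrite (_ : (fun t => _) = fun t => \int[gauss n]_v w t v); last first.
  by apply/funext => t; rewrite /Rintegral cameron_martin.
have mw t : measurable_fun setT (w t).
  by apply: measurable_funM => //; exact: measurable_cm_weight.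
(* For [|t| < 1] the derivative of the weight is at most [exp (2 |v_j|)], and
   [|a| b <= a^2 + b^2] separates the two factors. *)
pose G (v : 'rV[R]_n) := F v ^+ 2 + (expR (4 * v ord0 j) + expR (- 4 * v ord0 j)).
have iG : (gauss n).-integrable setT (EFin \o G).
  apply: integrable_addR => //.
  by apply: integrable_addR; exact: integrable_expR_coord.
have G0 v : 0 <= G v by rewrite !addr_ge0 ?sqr_ge0 ?expR_ge0.
have bound (a s t : R) : -1 < t < 1 ->
    `|a| * ((`|s| + 1) * expR (t * s - t ^+ 2 / 2)) <=
    a ^+ 2 + (expR (4 * s) + expR (- 4 * s)).
  move=> t1.
  have e1 : (`|s| + 1) * expR (t * s - t ^+ 2 / 2) <= expR `|s| * expR `|s|.
    apply: ler_pM; rewrite ?addr_ge0 ?expR_ge0//.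
      by rewrite addrC expR_ge1Dx.
    rewrite ler_expR.
    have : t * s <= `|s|.
      rewrite (le_trans (ler_norm _))// normrM ler_piMl// ltW// ltr_norml.
      by move: t1 => /andP[-> ->].
    by have := sqr_ge0 t; lra.
  apply: (le_trans (ler_wpM2l (normr_ge0 _) e1)).
  have e4 : expR `|s| ^+ 4 <= expR (4 * s) + expR (- 4 * s).
    rewrite -expRM_natl (le_trans _ (le_trans (expR_norm_le (4 * s)) _))//.
      by rewrite normrM ger0_norm.
    by rewrite mulNr.
  apply: (le_trans _ (lerD (lexx _) e4)).
  rewrite -[a ^+ 2]real_normK ?num_real//.
  have := sqr_ge0 (`|a| - expR `|s| * expR `|s|).
  by have := normr_ge0 a; have := expR_ge0 `|s|; nra.
have iw (t : R) : -1 < t < 1 -> (gauss n).-integrable setT (EFin \o w t).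
  move=> t1; apply: (integrable_dominated (mw t) _ iG) => v.
  apply: le_trans (bound (F v) (v ord0 j) t t1).
  rewrite normrM ler_wpM2l// ger0_norm ?expR_ge0// ler_peMl ?expR_ge0//.
  by rewrite lerDr.
have dw (t : R) (v : 'rV[R]_n) : is_derive t 1 (w ^~ v)
    (F v * ((v ord0 j - t) * expR (t * v ord0 j - t ^+ 2 / 2))).
  exact: is_derive_cm_weight.
have pw (t : R) (v : 'rV[R]_n) : partial1of2 w t v =
    F v * ((v ord0 j - t) * expR (t * v ord0 j - t ^+ 2 / 2)).
  by rewrite partial1of2E; exact: derive_val.
have I0 : `](-1)%R, 1%R[%classic (0 : R) by rewrite /= in_itv/=; lra.
have iw' (t : R) : `](-1)%R, 1%R[%classic t ->
    (gauss n).-integrable setT (EFin \o w t).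
  by rewrite /= in_itv/=; exact: iw.
have dw' (t : R) (v : 'rV[R]_n) :
    `](-1)%R, 1%R[%classic t -> setT v -> derivable (w ^~ v) t 1.
  by move=> _ _; exact: ex_derive.
have Gw (t : R) (v : 'rV[R]_n) :
    `](-1)%R, 1%R[%classic t -> setT v -> `|partial1of2 w t v| <= G v.
  rewrite /= in_itv/= => t1 _; rewrite pw.
  apply: le_trans (bound (F v) (v ord0 j) t t1).
  rewrite normrM ler_wpM2l// normrM [X in _ * X]ger0_norm ?expR_ge0//.
  rewrite ler_wpM2r ?expR_ge0// (le_trans (ler_normB _ _))// lerD2l.
  by rewrite ltW// ltr_norml.
apply: DeriveDef.
  exact: (derivable_under_integral measurableT I0 iw' dw' G0 iG Gw).
rewrite -derive1E (differentiation_under_integral measurableT I0 iw' dw' G0 iG Gw).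
apply: eq_Rintegral => v _; rewrite pw.
by rewrite [0 ^+ 2]expr2 !mul0r !subr0 expR0 mulr1.
Qed.

(** The next three moments come from [is_derive_gauss_shift], with [F] the
    constant [1], then [v_j], then [v_j^3]: the left-hand side is then the
    derivative of an explicit polynomial in [t]. *)
Lemma gauss_mean n (j : 'I_n) : \int[gauss n]_v (v ord0 j) = 0.
Proof.
have mF : measurable_fun setT (fun _ : 'rV[R]_n => 1 : R) by [].
have iF : (gauss n).-integrable setT (EFin \o (fun v : 'rV[R]_n => 1 ^+ 2)).
  exact: integrable_cstR.
have [_] := is_derive_gauss_shift j mF iF.
rewrite (_ : (fun t => _) = cst (1:R)) ?derive_cst; last first.
  by apply/funext => t; rewrite Rintegral_cstT.
by move=> ->; apply: eq_Rintegral => v _; rewrite mul1r.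
Qed.

Lemma gauss_moment2 n (j : 'I_n) : \int[gauss n]_v (v ord0 j ^+ 2) = 1.
Proof.
have [_] := is_derive_gauss_shift j (measurable_coord j) (integrable_coordX j 2).
under eq_fun => t.
  under eq_Rintegral do rewrite rV_shiftE eqxx mulr1.
  rewrite RintegralD//; last 2 first.
  - exact: (integrable_coordX j 1).
  - exact: integrable_cstR.
  rewrite gauss_mean add0r Rintegral_cstT.
  over.
by rewrite derive_id => ->; apply: eq_Rintegral => v _; rewrite expr2.
Qed.

Lemma gauss_moment4 n (j : 'I_n) : \int[gauss n]_v (v ord0 j ^+ 4) = 3.
Proof.
have mF : measurable_fun setT (fun v : 'rV[R]_n => v ord0 j ^+ 3 : R).
  by apply: measurable_funX; exact: measurable_coord.
have iF : (gauss n).-integrable setT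
    (EFin \o (fun v : 'rV[R]_n => (v ord0 j ^+ 3) ^+ 2)).
  under eq_fun do rewrite /= -exprM.
  exact: integrable_coordX.
have [_] := is_derive_gauss_shift j mF iF.
have -> : (fun t => \int[gauss n]_v ((v + t *: delta_mx ord0 j) ord0 j ^+ 3)) =
    fun t => \int[gauss n]_v (v ord0 j ^+ 3) + (3 * t + t ^+ 3).
  apply/funext => t.
  have i1 := @integrable_coordX R n j 1.
  have i2 := integrable_scaleR (3 * t) (integrable_coordX j 2).
  have i3 := @integrable_coordX R n j 3.
  have it := integrable_scaleR (3 * t ^+ 2) i1.
  have ic := integrable_cstR (gauss n) (t ^+ 3).
  transitivity (\int[gauss n]_v (v ord0 j ^+ 3 + (3 * t * v ord0 j ^+ 2 +
      (3 * t ^+ 2 * v ord0 j ^+ 1 + t ^+ 3)))).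
    by apply: eq_Rintegral => v _; rewrite rV_shiftE eqxx mulr1; ring.
  rewrite RintegralD//; last by do 2 apply: integrable_addR => //.
  rewrite RintegralD//; last exact: integrable_addR.
  rewrite RintegralD// (RintegralZl _ measurableT (@integrable_coordX R n j 2)).
  rewrite (RintegralZl _ measurableT i1).
  rewrite gauss_moment2 gauss_mean Rintegral_cstT.
  by rewrite mulr1 mulr0 add0r.
move=> d; transitivity (\int[gauss n]_v (v ord0 j ^+ 3 * v ord0 j)).
  by apply: eq_Rintegral => v _; rewrite -exprSr.
rewrite -d.
set m3 : R := \int[gauss n]_v _.
have d3 : is_derive (0 : R) 1 (fun t => m3 + (3 * t + t ^+ 3))
    (0 + (3 * 1 + (3 * 0 ^+ 2) * 1)).
  exact: (is_deriveD (is_derive_cst m3 (0 : R) 1)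
    (is_deriveD (is_deriveZ 3 (is_derive_id (0 : R) 1))
      (is_deriveX 3 (is_derive_id (0 : R) 1)))).
by rewrite derive_val; ring.
Qed.

End gaussian_derivative.

(** * Measurability of Lipschitz functions *)

Section lipschitz.
Context {R : realType}.

Lemma enorm_ge0 n (v : 'rV[R]_n) : 0 <= enorm v.
Proof. exact: sqrtr_ge0. Qed.

Lemma enorm_sqr n (v : 'rV[R]_n) : enorm v ^+ 2 = \sum_(i < n) v ord0 i ^+ 2.
Proof. by rewrite sqr_sqrtr// sumr_ge0// => i _; exact: sqr_ge0. Qed.

Lemma enormBC n (v w : 'rV[R]_n) : enorm (v - w) = enorm (w - v).
Proof.
by congr Num.sqrt; apply: eq_bigr => i _; rewrite !mxE -sqrrN opprB.
Qed.

Lemma measurable_enorm d (T : measurableType d) n (g : T -> 'rV[R]_n) :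
  (forall i, measurable_fun setT (fun w => g w ord0 i : R)) ->
  measurable_fun setT (fun w => enorm (g w)).
Proof.
move=> mg; apply: (@measurableT_comp _ _ _ _ _ _ (@Num.sqrt R)).
  by apply: continuous_measurable_fun; exact: sqrt_continuous.
by apply: measurable_sum => i; apply: measurable_funX; exact: mg.
Qed.

Lemma rat_rV_dense n (v : 'rV[R]_n) (e : R) : 0 < e ->
  exists q : 'rV[rat]_n, enorm (v - map_mx ratr q) <= e.
Proof.
move=> e0; pose eta := e / n.+1%:R.
(* Dividing by [n + 1] also covers [n = 0], and [n eta^2 <= e^2]. *)
have eta0 : 0 < eta by rewrite divr_gt0// ltr0n.
have /choice[q qP] (i : 'I_n) : exists q : rat, `|v ord0 i - ratr q| <= eta.
  have [q] := @rat_in_itvoo R (v ord0 i - eta) (v ord0 i + eta) ltac:(lra).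
  by rewrite in_itv/= => /andP[? ?]; exists q; rewrite ler_norml; lra.
exists (\row_i q i).
have enneg : e \is Num.nneg by rewrite nnegrE ltW.
have etanneg : eta \is Num.nneg by rewrite nnegrE ltW.
rewrite -(ler_pXn2r (n := 2)) ?nnegrE ?enorm_ge0// enorm_sqr.
apply: (@le_trans _ _ (\sum_(i < n) eta ^+ 2)).
  apply: ler_sum => i _; rewrite !mxE -[leLHS]real_normK ?num_real//.
  by rewrite ler_pXn2r// ?nnegrE.
rewrite sumr_const card_ord -mulr_natl /eta expr_div_n mulrA.
rewrite ler_pdivrMr ?exprn_gt0 ?ltr0n// mulrC ler_wpM2l ?sqr_ge0//.
by rewrite -natrX ler_nat expnS expn1 mulSn (leq_trans (leqnSn n))// leq_addr.
Qed.

(** By the Lipschitz bound, [f v < a] holds exactly when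
    [f q + L |v - q| < a] for some rational vector [q], so the sublevel sets of
    [f] are countable unions of preimages under the measurable function
    [v |-> |v - q|]. *)
Lemma measurable_elipschitz n (L : R) (f : 'rV[R]_n -> R) :
  0 <= L -> elipschitz L f -> measurable_fun setT f.
Proof.
move=> L0 fL; apply: (measurability _ (RGenInftyO.measurableE R)) => //.
move=> /= _ [_ [a ->] <-]; rewrite setTI.
rewrite (_ : _ @^-1` _ = \bigcup_(q : 'rV[rat]_n)
    [set v | f (map_mx ratr q) + L * enorm (v - map_mx ratr q) < a]).
  apply: countable_bigcupT_measurable; first exact: countableP.
  move=> q; rewrite -[X in measurable X]setTI -preimage_itvNyo.
  suff mg : measurable_fun setT (fun v : 'rV[R]_n =>
      f (map_mx ratr q) + L * enorm (v - map_mx ratr q)) by exact: mg.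
  apply: measurable_funD => //; apply: measurable_funM => //.
  apply: measurable_enorm => i.
  under eq_fun do rewrite !mxE.
  by apply: measurable_funB => //; exact: measurable_coord.
apply/seteqP; split => [v|v [q _]] /=; rewrite in_itv/=.
- move=> fva.
  (* Passing through [q] costs at most [2 L |v - q|]; the [+ 1] allows [L = 0]. *)
  have e0 : 0 < (a - f v) / (2 * L + 1) by rewrite divr_gt0; lra.
  have [q qe] := rat_rV_dense v e0; exists q => //=.
  have h := fL (map_mx ratr q) v.
  rewrite enormBC ler_norml in h; case/andP: h => _ h.
  set D := enorm _ in qe h *.
  have D0 : 0 <= D by exact: enorm_ge0.
  rewrite ler_pdivlMr in qe; last lra.
  have [/eqP D00|D00] := boolP (D == 0); first by nra.
  have : 0 < D by rewrite lt_neqAle eq_sym D00.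
  nra.
- have h := fL v (map_mx ratr q).
  by move: h; rewrite ler_norml => /andP[_ h]; lra.
Qed.

End lipschitz.

(** * Sums of independent identically distributed variables *)

Section iid.
Context d d' (T : measurableType d) (E : measurableType d') (R : realType).
Context (P : probability T R) (Q : probability E R).

Lemma has_law_integrable (X : {RV P >-> E}) (g : E -> R) :
  has_law X Q -> Q.-integrable setT (EFin \o g) ->
  P.-integrable setT (EFin \o (g \o X)).
Proof.
move=> XQ ig; have mg := integrable_measurable ig.
have /integrableP[_ goo] := ig.
apply/integrableP; split.
  by apply/measurable_EFinP; exact: measurableT_comp.
rewrite (eq_measure_integral (distribution P X)) in goo; last first.
  by move=> A mA _; exact/esym/XQ.
by rewrite ge0_integral_distribution// in goo; do 2 apply: measurableT_comp => //.
Qed.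

Lemma has_law_Rintegral (X : {RV P >-> E}) (g : E -> R) :
  has_law X Q -> Q.-integrable setT (EFin \o g) ->
  \int[P]_w g (X w) = \int[Q]_v g v.
Proof.
move=> XQ ig; have mg := integrable_measurable ig.
rewrite /Rintegral (eq_measure_integral (distribution P X)); last first.
  by move=> A mA _; exact/esym/XQ.
rewrite integral_distribution//; first exact/measurable_EFinP.
exact: has_law_integrable.
Qed.

(** Independence on events says that the joint law of [X] and [Y] agrees with
    [Q x Q] on rectangles, hence everywhere; Fubini then factors the integral
    of [h x h]. *)
Lemma Rintegral_indep_mul_eq0 (X Y : {RV P >-> E}) (h : E -> R) :
  has_law X Q -> has_law Y Q ->
  (forall A B, measurable A -> measurable B ->
    P (X @^-1` A `&` Y @^-1` B) = (P (X @^-1` A) * P (Y @^-1` B))%E) ->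
  measurable_fun setT h ->
  Q.-integrable setT (EFin \o (fun v => h v ^+ 2)) ->
  \int[Q]_v h v = 0 ->
  \int[P]_w (h (X w) * h (Y w)) = 0.
Proof.
move=> XQ YQ XY mh ih2 h0.
have ih := integrable_sqr_integrable mh ih2.
pose Z w : E * E := (X w, Y w).
have mZ : measurable_fun setT Z by exact: measurable_fun_pair.
pose Zm := isMeasurableFun.Build _ _ _ _ Z mZ.
pose Zf : {mfun T >-> (E * E)%type} := HB.pack Z Zm.
pose H (p : E * E) := (h p.1 * h p.2)%:E.
have mH : measurable_fun setT H.
  apply/measurable_EFinP; apply: measurable_funM.
    exact: measurableT_comp mh measurable_fst.
  exact: measurableT_comp mh measurable_snd.
have iH : P.-integrable setT (H \o Zf).
  apply: (@integrable_mul_sqr _ _ _ P (h \o X) (h \o Y)).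
  - exact: measurableT_comp.
  - exact: measurableT_comp.
  - exact: (has_law_integrable XQ ih2).
  - exact: (has_law_integrable YQ ih2).
have ZQ A : measurable A -> (Q \x Q)%E A = distribution P Zf A.
  move=> mA; apply: product_measure_unique => // B C mB mC.
  rewrite /= -XQ// -YQ//; exact: XY.
have iHQ : (Q \x Q)%E.-integrable setT H.
  apply/integrableP; split => //.
  rewrite (eq_measure_integral (distribution P Zf)) => [|A mA _]; last exact: ZQ.
  rewrite ge0_integral_distribution//; last exact: measurableT_comp.
  by have /integrableP[] := iH.
rewrite /Rintegral -[X in fine X](integral_distribution mH iH).
rewrite (eq_measure_integral (Q \x Q)%E) => [|A mA _]; last exact/esym/ZQ.
rewrite -integral12_prod_meas1//= /fubini_F.
under eq_integral => v _.
  rewrite /H/=; under eq_integral do rewrite EFinM.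
  rewrite integralZl// -[X in (_ * X)%E]fineK ?(integrable_fin_num measurableT ih)//.
  rewrite -[X in (_ * X%:E)%E]/(\int[Q]_v h v) h0 mule0; over.
by rewrite integral0.
Qed.

Lemma mutually_independent_pair (I : finType) (X : I -> {RV P >-> E}) (i k : I) :
  mutually_independent X -> i != k ->
  forall A B, measurable A -> measurable B ->
    P (X i @^-1` A `&` X k @^-1` B) = (P (X i @^-1` A) * P (X k @^-1` B))%E.
Proof.
move=> Xind ik A B mA mB.
pose F l := if l == i then A else B.
have mF l : measurable (F l) by rewrite /F; case: ifP.
have ki : (k == i) = false by rewrite eq_sym (negbTE ik).
have := Xind [set i; k]%SET F mF.
rewrite big_setU1 ?inE// big_set1 /F eqxx ki => <-; congr (P _).
apply/seteqP; split => [w [Aw Bw] l /=|w h].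
  by rewrite !inE => /orP[|] /eqP ->; rewrite ?eqxx ?ki.
split; first by have := h i; rewrite /= !inE eqxx; apply.
by have := h k; rewrite /= !inE eqxx orbT ki; apply.
Qed.

(** In the expansion of the square, only the diagonal terms have a nonzero
    mean. *)
Lemma Rintegral_iid_sum_sqr N (X : 'I_N -> {RV P >-> E}) (h : E -> R) :
  mutually_independent X -> (forall i, has_law (X i) Q) ->
  measurable_fun setT h ->
  Q.-integrable setT (EFin \o (fun v => h v ^+ 2)) ->
  \int[Q]_v h v = 0 ->
  P.-integrable setT (EFin \o (fun w => (\sum_(i < N) h (X i w)) ^+ 2)) /\
  \int[P]_w ((\sum_(i < N) h (X i w)) ^+ 2) = N%:R * \int[Q]_v (h v ^+ 2).
Proof.
move=> Xind XQ mh ih2 h0.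
have ihh i k : P.-integrable setT (EFin \o (fun w => h (X i w) * h (X k w))).
  apply: (@integrable_mul_sqr _ _ _ P (h \o X i) (h \o X k)).
  - exact: measurableT_comp.
  - exact: measurableT_comp.
  - exact: (has_law_integrable (XQ i) ih2).
  - exact: (has_law_integrable (XQ k) ih2).
have sumE w : (\sum_(i < N) h (X i w)) ^+ 2 =
    \sum_(i < N) \sum_(k < N) h (X i w) * h (X k w).
  by rewrite expr2 mulr_suml; apply: eq_bigr => i _; rewrite mulr_sumr.
have isum i : P.-integrable setT
    (EFin \o (fun w => \sum_(k < N) h (X i w) * h (X k w))).
  exact: integrable_sumR.
split.
  under [X in EFin \o X]eq_fun do rewrite sumE.
  exact: integrable_sumR.
under eq_Rintegral do rewrite sumE.
rewrite Rintegral_sum//.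
under eq_bigr => i _.
  rewrite Rintegral_sum// (bigD1 i)//= big1 ?addr0 => [|k ki].
    under eq_Rintegral do rewrite -expr2.
    rewrite (has_law_Rintegral (XQ i) ih2).
    over.
  apply: Rintegral_indep_mul_eq0 => //.
  by apply: mutually_independent_pair => //; rewrite eq_sym.
by rewrite sumr_const card_ord mulr_natl.
Qed.

End iid.

(** * Markov inequality *)

Section markov.
Context d (T : measurableType d) (R : realType) (P : probability T R).

Lemma markov_ge0 (V : T -> R) (a : R) : 0 < a -> (forall w, 0 <= V w) ->
  P.-integrable setT (EFin \o V) ->
  (P [set w | (a <= V w)%R] <= ((\int[P]_w V w)%R / a)%:E)%E.
Proof.
move=> a0 V0 iV; have mV := integrable_measurable iV.
pose Vm := isMeasurableFun.Build _ _ _ _ V mV.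
pose Vf : {mfun T >-> R} := HB.pack V Vm.
have := @markov _ _ _ P Vf id a a0 (@measurable_id _ _ _) (fun _ => id).
rewrite unlock => /(_ _)/wrap[]; first by move=> ? ? _ _.
rewrite (_ : [set w | _] = [set w | (a <= V w)%R]); last first.
  by apply/seteqP; split => w /=; rewrite lee_fin ger0_norm.
under eq_integral do rewrite /= ger0_norm//.
rewrite -[X in (_ <= X)%E](fineK (integrable_fin_num measurableT iV)).
by rewrite EFinM lee_pdivlMr// muleC.
Qed.

End markov.

(** * One sample of the gradient estimator *)

Section gauss_gradient.
Context {R : realType}.
Local Notation gauss n := (std_normal R n).
Context (n : nat) (f : 'rV[R]_n -> R) (L : R).
Context (L0 : 0 <= L) (fL : elipschitz L f).
Context (sigma : R) (sigma0 : 0 < sigma) (x : 'rV[R]_n).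

Let F (v : 'rV[R]_n) := f (x + sigma *: v).

Let sigma_neq0 : sigma != 0. Proof. by rewrite gt_eqF. Qed.

Lemma measurable_lip_affine : measurable_fun setT F.
Proof.
apply: measurableT_comp; first exact: measurable_elipschitz fL.
apply/measurable_fun_rVP => i.
rewrite (_ : _ \o _ = fun v : 'rV[R]_n => x ord0 i + sigma * v ord0 i); last first.
  by apply/funext => v /=; rewrite /rV_coord !mxE.
by apply: measurable_funD => //; apply: measurable_funM => //; exact: measurable_coord.
Qed.

Lemma lip_increment_sqr v :
  ((F v - f x) / sigma) ^+ 2 <= L ^+ 2 * \sum_(k < n) v ord0 k ^+ 2.
Proof.
have := fL (x + sigma *: v) x; rewrite -/(F v) => h.
have : `|F v - f x| ^+ 2 <= (L * enorm (x + sigma *: v - x)) ^+ 2.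
  by rewrite ler_pXn2r// nnegrE mulr_ge0// enorm_ge0.
rewrite real_normK ?num_real// exprMn enorm_sqr => {}h.
rewrite expr_div_n ler_pdivrMr ?exprn_gt0// (le_trans h)// -[leRHS]mulrA.
rewrite ler_wpM2l ?sqr_ge0// mulr_suml ler_sum// => k _.
by rewrite !mxE addrAC subrr add0r exprMn mulrC.
Qed.

Let G (j : 'I_n) (v : 'rV[R]_n) := (F v - f x) / sigma * v ord0 j.

Lemma measurable_grad_sample j : measurable_fun setT (G j).
Proof.
apply: measurable_funM; last exact: measurable_coord.
apply: measurable_funM => //; apply: measurable_funB => //.
exact: measurable_lip_affine.
Qed.

(* An upper bound of [G j ^+ 2] that only involves fourth moments of single
   coordinates, from [2 v_k^2 v_j^2 <= v_k^4 + v_j^4]. *)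
Let D j (v : 'rV[R]_n) : R :=
  L ^+ 2 / 2 * \sum_(k < n) (v ord0 k ^+ 4 + v ord0 j ^+ 4).

Let grad_sample_le j v : G j v ^+ 2 <= D j v.
Proof.
rewrite exprMn; apply: (le_trans (ler_wpM2r (sqr_ge0 _) (lip_increment_sqr v))).
rewrite /D -[leLHS]mulrA -[leRHS]mulrA ler_wpM2l ?sqr_ge0//.
rewrite mulr_suml mulr_sumr ler_sum// => k _.
have := sqr_ge0 (v ord0 k ^+ 2 - v ord0 j ^+ 2).
by rewrite -[4%N]/(2 * 2)%N !exprM; lra.
Qed.

Let integrable_D j : (gauss n).-integrable setT (EFin \o D j).
Proof.
apply: integrable_scaleR; apply: integrable_sumR => k.
by apply: integrable_addR; exact: integrable_coordX.
Qed.

Lemma integrable_grad_sample_sqr j :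
  (gauss n).-integrable setT (EFin \o (fun v => G j v ^+ 2)).
Proof.
apply: integrable_dominated (integrable_D j).
  by apply: measurable_funX; exact: measurable_grad_sample.
by move=> v; rewrite ger0_norm ?sqr_ge0//; exact: grad_sample_le.
Qed.

Lemma Rintegral_grad_sample_sqr j :
  \int[gauss n]_v (G j v ^+ 2) <= 3 * n%:R * L ^+ 2.
Proof.
have i4 k := @integrable_coordX R n k 4.
apply: (@le_trans _ _ (\int[gauss n]_v D j v)).
  apply: le_Rintegral => //; exact: integrable_grad_sample_sqr.
have isum : (gauss n).-integrable setT
    (EFin \o (fun v => \sum_(k < n) (v ord0 k ^+ 4 + v ord0 j ^+ 4))).
  by apply: integrable_sumR => k; apply: integrable_addR; exact: i4.
rewrite (RintegralZl _ measurableT isum) Rintegral_sum => [|k]; last first.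
  by apply: integrable_addR; exact: i4.
under eq_bigr do rewrite (RintegralD measurableT (i4 _) (i4 _)) !gauss_moment4.
by rewrite sumr_const card_ord -mulr_natl; lra.
Qed.

(** The bound is [a^2 <= 2 b^2 + 2 (a - b)^2] with [a = F v] and [b = f x]. *)
Lemma integrable_lip_affine_sqr :
  (gauss n).-integrable setT (EFin \o (fun v => F v ^+ 2)).
Proof.
apply: (@integrable_dominated _ _ _ (gauss n) _ (fun v => 2 * f x ^+ 2 +
    2 * sigma ^+ 2 * L ^+ 2 * \sum_(k < n) v ord0 k ^+ 2)).
- by apply: measurable_funX; exact: measurable_lip_affine.
- move=> v; rewrite ger0_norm ?sqr_ge0//.
  have := lip_increment_sqr v.
  rewrite expr_div_n ler_pdivrMr ?exprn_gt0// => h.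
  have := sqr_ge0 (F v - 2 * f x).
  move: h; set S := \sum_(k < n) _ => h1 h2.
  nra.
- apply: integrable_addR; first exact: integrable_cstR.
  apply: integrable_scaleR; apply: integrable_sumR => k.
  exact: integrable_coordX.
Qed.

(** Moving [x] by [t e_j] shifts the Gaussian vector by [(t / sigma) e_j], which
    reduces the partial derivative to [is_derive_gauss_shift] and the chain
    rule. *)
Lemma gradient_gauss_smoothing j :
  gradient (gauss_smoothing sigma f) x ord0 j = \int[gauss n]_v G j v.
Proof.
have mF := measurable_lip_affine.
have iF2 := integrable_lip_affine_sqr.
rewrite mxE.
pose Psi (t : R) := \int[gauss n]_v F (v + t *: delta_mx ord0 j).
have phiE (t : R) : gauss_smoothing sigma f (x + t *: delta_mx ord0 j) =
    Psi (sigma^-1 * t).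
  rewrite /gauss_smoothing unlock /Psi /Rintegral; congr fine.
  apply: eq_integral => v _; rewrite /F scalerDr scalerA mulrA divff// mul1r.
  by rewrite -addrA [_ *: delta_mx _ _ + _]addrC.
transitivity ('D_1 (fun t : R => Psi (sigma^-1 * t)) 0).
  rewrite /derive [X in lim (X @ _) = _](_ : _ = fun h : R => h^-1 *:
    (((fun t : R => Psi (sigma^-1 * t)) \o shift 0) (h *: 1) -
      Psi (sigma^-1 * 0)))//.
  apply/funext => h; congr (_ *: (_ - _)) => /=.
    by rewrite addrC phiE addr0 [h *: 1]mulr1.
  by rewrite -phiE scale0r addr0.
have dg : is_derive (0 : R) 1 (fun t : R => sigma^-1 * t) (sigma^-1 * 1).
  exact: (is_deriveZ sigma^-1 (is_derive_id (0 : R) 1)).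
have dPsi : is_derive (sigma^-1 * 0) 1 Psi (\int[gauss n]_v (F v * v ord0 j)).
  by rewrite mulr0; exact: is_derive_gauss_shift.
have d := is_derive1_comp dPsi dg.
rewrite [LHS](@derive_val _ _ _ _ _ _ _ d).
have iFv : (gauss n).-integrable setT (EFin \o (fun v => F v * v ord0 j)).
  apply: integrable_mul_sqr => //; first exact: measurable_coord.
  exact: integrable_coordX.
have iv := @integrable_coordX R n j 1.
transitivity (\int[gauss n]_v (sigma^-1 * (F v * v ord0 j) +
    (- f x / sigma) * v ord0 j)); last first.
  by apply: eq_Rintegral => v _; rewrite /G; field.
rewrite RintegralD//; [|exact: integrable_scaleR|exact: integrable_scaleR].
by rewrite RintegralZl// (RintegralZl _ measurableT iv) gauss_mean; field.
Qed.

End gauss_gradient.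

(** * Sample complexity *)

Theorem theorem3p5 (R : realType) (n : nat) (f : 'rV[R]_n -> R) (Lf : R)
    (hf : elipschitz Lf f) (sigma : R) (hsigma : 0 < sigma)
    (x : 'rV[R]_n) (r : R) (hr : 0 < r)
    (delta : R) (hdelta0 : 0 < delta) (hdelta1 : delta < 1)
    (N : nat) (hN : (0 < N)%N)
    (d : measure_display) (T : measurableType d) (P : probability T R)
    (u : 'I_N -> {RV P >-> 'rV[R]_n})
    (hu_indep : mutually_independent u)
    (hu_law : forall i, has_law (u i) (std_normal R n))
    (hsize :
      2 * n%:R * enorm (gradient (gauss_smoothing sigma f) x) ^+ 2
        / (delta * r ^+ 2)
      + (Lf ^+ 2 * n%:R * (n%:R + 2) * (n%:R + 4)
         + 8 * n%:R * (n%:R + 2) * Lf ^+ 2 + 16 * n%:R * Lf ^+ 2)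
        / (4 * delta * r ^+ 2) <= N%:R) :
  ((1 - delta)%:E <=
   P [set w | (enorm (grad_estimate sigma f (fun i => u i w) x
                      - gradient (gauss_smoothing sigma f) x) <= r)%R])%E.
Proof.
(* For [n = 0] the Lipschitz bound does not force [Lf] to be nonnegative. *)
have fL : elipschitz `|Lf| f.
  by move=> y z; rewrite (le_trans (hf y z))// ler_wpM2r ?enorm_ge0 ?ler_norm.
have N0 : 0 < N%:R :> R by rewrite ltr0n.
pose G (j : 'I_n) (v : 'rV[R]_n) := (f (x + sigma *: v) - f x) / sigma * v ord0 j.
pose c j := \int[std_normal R n]_v G j v.
pose h j v := G j v - c j.
have mG j : measurable_fun setT (G j).
  exact: (measurable_grad_sample (normr_ge0 Lf) fL).
have iG2 j : (std_normal R n).-integrable setT (EFin \o (fun v => G j v ^+ 2)).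
  exact: (integrable_grad_sample_sqr (normr_ge0 Lf) fL hsigma).
have iG j : (std_normal R n).-integrable setT (EFin \o G j).
  exact: integrable_sqr_integrable.
have mh j : measurable_fun setT (h j) by exact: measurable_funB.
have h0 j : \int[std_normal R n]_v h j v = 0.
  rewrite /h RintegralB//; last exact: integrable_cstR.
  by rewrite Rintegral_cstT subrr.
have hE j v : h j v ^+ 2 = G j v ^+ 2 + (- 2 * c j * G j v + c j ^+ 2).
  by rewrite /h; ring.
have ih2 j : (std_normal R n).-integrable setT (EFin \o (fun v => h j v ^+ 2)).
  under [X in EFin \o X]eq_fun do rewrite hE.
  apply: integrable_addR => //; apply: integrable_addR; last exact: integrable_cstR.
  exact: integrable_scaleR.
have h2 j : \int[std_normal R n]_v (h j v ^+ 2) <= 3 * n%:R * Lf ^+ 2.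
  under eq_Rintegral do rewrite hE.
  have i1 : (std_normal R n).-integrable setT (EFin \o (fun v => - 2 * c j * G j v)).
    exact: integrable_scaleR.
  have i2 := integrable_cstR (std_normal R n) (c j ^+ 2).
  rewrite RintegralD//; last exact: integrable_addR.
  rewrite RintegralD// RintegralZl// Rintegral_cstT -/(c j).
  have := Rintegral_grad_sample_sqr (normr_ge0 Lf) fL hsigma x j.
  rewrite real_normK ?num_real// -/(G j) => hG.
  have := sqr_ge0 (c j).
  nra.
pose V w := \sum_(j < n) (N%:R^-1 ^+ 2 * (\sum_(i < N) h j (u i w)) ^+ 2).
have iid j := Rintegral_iid_sum_sqr hu_indep hu_law (mh j) (ih2 j) (h0 j).
have iV1 j : P.-integrable setT
    (EFin \o (fun w => N%:R^-1 ^+ 2 * (\sum_(i < N) h j (u i w)) ^+ 2)).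
  by apply: integrable_scaleR; exact: (iid j).1.
have iV : P.-integrable setT (EFin \o V) by exact: integrable_sumR.
have V0 w : 0 <= V w.
  by apply: sumr_ge0 => j _; rewrite mulr_ge0 ?sqr_ge0.
have EV : \int[P]_w V w <= 3 * n%:R ^+ 2 * Lf ^+ 2 / N%:R.
  rewrite Rintegral_sum//.
  apply: (@le_trans _ _ (\sum_(j < n) 3 * n%:R * Lf ^+ 2 / N%:R)).
    apply: ler_sum => j _; rewrite RintegralZl//; last exact: (iid j).1.
    rewrite (iid j).2 mulrA exprVn expr2 invfM mulfVK ?gt_eqF// mulrC.
    by rewrite ler_wpM2r// invr_ge0 ltW.
  rewrite sumr_const card_ord -mulr_natl le_eqVlt; apply/orP; left; apply/eqP.
  by field; rewrite gt_eqF.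
have VE w : enorm (grad_estimate sigma f (fun i => u i w) x
    - gradient (gauss_smoothing sigma f) x) ^+ 2 = V w.
  rewrite enorm_sqr; apply: eq_bigr => j _; rewrite -exprMn; congr (_ ^+ 2).
  rewrite mxE [X in _ + X]mxE (gradient_gauss_smoothing (normr_ge0 Lf) fL)//.
  rewrite -/(G j) -/(c j) mxE summxE.
  under eq_bigr do rewrite mxE -/(G j _).
  rewrite /h sumrB sumr_const card_ord -[c j *+ N]mulr_natl mulrBr mulrA mulVf ?gt_eqF//.
  by rewrite mul1r.
have r2 : 0 < r ^+ 2 by rewrite exprn_gt0.
set A := [set w | _]; pose B := [set w | r ^+ 2 < V w].
have mV := integrable_measurable iV.
have mB : measurable B.
  rewrite -[B]setTI (_ : B = V @^-1` `]r ^+ 2, +oo[); last first.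
    by apply/seteqP; split => w /=; rewrite in_itv/= andbT.
  exact: mV.
have -> : A = ~` B.
  have rE w : (r ^+ 2 < V w) = ~~ (enorm (grad_estimate sigma f (u^~ w) x -
      gradient (gauss_smoothing sigma f) x) <= r).
    by rewrite -VE -ltNge ltr_pXn2r ?nnegrE ?enorm_ge0// ltW.
  by apply/seteqP; split => w; rewrite /A /B /= rE; [move=> ->|move/negP; rewrite negbK].
rewrite probability_setC// EFinB leeB//.
apply: (@le_trans _ _ (P [set w | (r ^+ 2 <= V w)%R])).
  apply: le_measure; rewrite ?inE//; last by move=> w /ltW.
  rewrite -[X in measurable X]setTI (_ : [set w | _] = V @^-1` `[r ^+ 2, +oo[).
    exact: mV.
  by apply/seteqP; split => w /=; rewrite in_itv/= andbT.
apply: (le_trans (markov_ge0 r2 V0 iV)); rewrite lee_fin.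
rewrite ler_pdivrMr// (le_trans EV)// ler_pdivrMr//.
have dr : 0 < delta * r ^+ 2 by rewrite mulr_gt0.
set gr := enorm _ in hsize; set n' : R := n%:R in hsize *.
have n0 : 0 <= n' by rewrite ler0n.
have L2 := sqr_ge0 Lf.
have t1 : 0 <= 2 * n' * gr ^+ 2 / (delta * r ^+ 2).
  by apply: divr_ge0; [rewrite mulr_ge0 ?sqr_ge0// mulr_ge0|exact: ltW].
rewrite -(mulrA 4) in hsize.
set K := _ + 16 * n' * Lf ^+ 2 in hsize.
have : K / (4 * (delta * r ^+ 2)) <= N%:R by apply: le_trans hsize; rewrite lerDr.
rewrite ler_pdivrMr ?mulr_gt0// => KN.
have nL : 0 <= Lf ^+ 2 * n' * (n' ^+ 2 + 2 * n' + 40).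
  by apply: mulr_ge0; [rewrite mulr_ge0|have := sqr_ge0 n'; lra].
have -> : 3 * n' ^+ 2 * Lf ^+ 2 =
    (K - Lf ^+ 2 * n' * (n' ^+ 2 + 2 * n' + 40)) / 4 by rewrite /K; field.
lra.
Qed.
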